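(* Let $p\ge 0$, $0\le q\le 1$, $C\ge 0$, let $T\ge 1$ be an integer, and let $Q_t$, $V_t$ ($t=0,\dots,T-1$) be the state-action value functions and profit-to-go functions defined in the context. Then for every $t\in\{0,\dots,T-1\}$ and every $F\in[0,1)$ there is a unique optimal price $\pi^\star_t(F)$, i.e. a unique maximizer of $Q_t(F,\cdot)$ over $\pi\ge 0$. Furthermore: (1) $\pi^\star_t(F)>0$ for all $t=0,\dots,T-1$ and $F\in[0,1)$; (2) $\pi^\star_t$ is differentiable with $[\pi^\star_t]'(F)\ge 0$ for all $t=0,\dots,T-1$ and $F\in[0,1)$ (one-sided derivative at $F=0$); (3) $\pi^\star_t(F)\ge\pi^\star_{t+1}(F)$ for all $t=0,\dots,T-2$ and $F\in[0,1)$.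
   Context: Let $R(F,\pi)=\dfrac{e^{p+qF-\pi}}{1+e^{p+qF-\pi}}$ for $F\in[0,1]$, $\pi\ge 0$. The fraction of adopters evolves as $F_{t+1}=F_t+(1-F_t)R(F_t,\pi_t)$, which stays in $[0,1]$. The profit-to-go functions on $[0,1]$ are defined backward in time by $$Q_{T-1}(F,\pi)=(\pi-C)(1-F)R(F,\pi),\qquad V_{T-1}(F)=\sup_{\pi\ge 0}Q_{T-1}(F,\pi),$$ and for $t=T-2,\dots,0$, $$Q_t(F,\pi)=(\pi-C)(1-F)R(F,\pi)+V_{t+1}\big(F+(1-F)R(F,\pi)\big),\qquad V_t(F)=\sup_{\pi\ge 0}Q_t(F,\pi).$$ *)

(* Defs.v *)
(* Stdlib real numbers with Coquelicot. *)
From Stdlib Require Import Reals Lra Lia.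
From Coquelicot Require Import Coquelicot.
Open Scope R_scope.

Definition adoption_rate (p q F pi : R) : R :=
  exp (p + q * F - pi) / (1 + exp (p + q * F - pi)).

Definition next_fraction (p q F pi : R) : R :=
  F + (1 - F) * adoption_rate p q F pi.

Definition stage_profit (p q C F pi : R) : R :=
  (pi - C) * (1 - F) * adoption_rate p q F pi.

(* [real] sends an infinite supremum to 0; this does not happen here, because
   for F in [0,1] the functions of pi to which [sup_price] is applied below are
   bounded above on pi >= 0. *)
Definition sup_price (f : R -> R) : R :=
  real (Lub_Rbar (fun y => exists pi, 0 <= pi /\ y = f pi)).

(* Indexed by the number n of periods remaining after the current one, so that
   the backward recursion in t becomes structural. *)
Fixpoint Q_remaining (p q C : R) (n : nat) (F pi : R) : R :=
  match n with
  | O => stage_profit p q C F pi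
  | S m => stage_profit p q C F pi
           + sup_price (Q_remaining p q C m (next_fraction p q F pi))
  end.

(* Meaningful for t < T only (truncated subtraction on nat). *)
Definition Q (p q C : R) (T t : nat) (F pi : R) : R :=
  Q_remaining p q C (T - 1 - t) F pi.

Definition V (p q C : R) (T t : nat) (F : R) : R :=
  sup_price (Q p q C T t F).

Lemma Q_last (p q C : R) (T : nat) (F pi : R) :
  Q p q C T (T - 1) F pi = (pi - C) * (1 - F) * adoption_rate p q F pi.
Proof. unfold Q. now rewrite Nat.sub_diag. Qed.

Lemma Q_step (p q C : R) (T t : nat) (F pi : R) : (S t < T)%nat ->
  Q p q C T t F pi =
    (pi - C) * (1 - F) * adoption_rate p q F pi
    + V p q C T (S t) (F + (1 - F) * adoption_rate p q F pi).
Proof.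
intros Ht. unfold V, Q.
now replace (T - 1 - t)%nat with (S (T - 1 - S t)) by lia.
Qed.

Definition optimal_price (p q C : R) (T t : nat) (F pi : R) : Prop :=
  0 <= pi /\ forall pi', 0 <= pi' -> Q p q C T t F pi' <= Q p q C T t F pi.

(* Main.v *)
(* Write w for the derivative of the continuation value and F' for the next
   fraction of adopters. The first-order condition for pi reads
     pi - C - 1 - exp (p + q F - pi) + w (F') = 0.
   If w <= 0 and w is nonincreasing, the left-hand side increases in pi with
   slope at least 1, so its root is the unique maximizer; it is nondecreasing in
   F because both -exp and w(F') decrease in F. By the envelope formula the new
   value has slope 1 + C - pi(F) + q (1 - F) R, which is again nonpositive and
   nonincreasing since q <= 1. Finally, a smaller w yields a larger root, hence a
   smaller new slope, which gives monotonicity in time by induction. *)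
Require Import Defs.
From Stdlib Require Import Reals Lra Lia.
From Coquelicot Require Import Coquelicot.
Open Scope R_scope.

(** * Maximizers, attained suprema and monotonicity from the derivative *)

(** Names the maximizer without a choice principle: when it is unique, the set of maximizers is a
    singleton and its supremum is that point. *)
Definition argmax_price (f : R -> R) : R :=
  real (Lub_Rbar (fun x => 0 <= x /\ forall y, 0 <= y -> f y <= f x)).

Lemma argmax_price_unique (f : R -> R) (x : R) :
  unique (fun x => 0 <= x /\ forall y, 0 <= y -> f y <= f x) x ->
  argmax_price f = x.
Proof.
intros [Hx Hu]. unfold argmax_price.
erewrite is_lub_Rbar_unique with (l := Finite x); [reflexivity|].
split.
- intros y Hy. rewrite (Hu y Hy). apply Rbar_le_refl.
- intros b Hb. now apply Hb.
Qed.

Lemma sup_price_max (f : R -> R) (x : R) :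
  0 <= x -> (forall y, 0 <= y -> f y <= f x) -> sup_price f = f x.
Proof.
intros Hx Hm. unfold sup_price.
erewrite is_lub_Rbar_unique with (l := Finite (f x)); [reflexivity|].
split.
- intros y [z [Hz ->]]. now apply Hm.
- intros b Hb. apply Hb. now exists x.
Qed.

Lemma nonincreasing_of_derive (f df : R -> R) (a b : R) :
  a <= b ->
  (forall x, a <= x <= b -> is_derive f x (df x) /\ df x <= 0) ->
  f b <= f a.
Proof.
intros Hab Hd.
destruct (MVT_gen f a b df) as [c [Hc He]].
- intros x Hx. rewrite Rmin_left, Rmax_right in Hx by lra. apply Hd; lra.
- intros x Hx. rewrite Rmin_left, Rmax_right in Hx by lra.
  apply derivable_continuous_pt. exists (df x).
  apply is_derive_Reals, Hd; lra.
- rewrite Rmin_left, Rmax_right in Hc by lra.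
  destruct (Hd c Hc) as [_ H]. nra.
Qed.

(** * Caratheodory slopes *)

(** With [d] filled in at [x0], continuity at [x0] amounts to differentiability with derivative [d].
    Factoring differences through such slopes does the work of the implicit function theorem and
    also covers the boundary state 0. *)
Definition slope (f : R -> R) (d x0 x : R) : R :=
  if Req_EM_T x x0 then d else (f x - f x0) / (x - x0).

Lemma slope_spec (f : R -> R) (d x0 x : R) :
  f x - f x0 = slope f d x0 x * (x - x0).
Proof.
unfold slope. destruct (Req_EM_T x x0) as [->|H]; [ring|field; lra].
Qed.

Lemma slope_diag (f : R -> R) (d x0 : R) : slope f d x0 x0 = d.
Proof. unfold slope. now destruct (Req_EM_T x0 x0). Qed.

Lemma slope_continuous (f : R -> R) (d x0 : R) :
  is_derive f x0 d -> continuous (slope f d x0) x0.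
Proof.
intros Hd. apply is_derive_Reals in Hd.
apply continuity_pt_filterlim.
intros eps He. destruct (Hd eps He) as [delta Hdelta].
exists delta. split; [apply cond_pos|].
intros x [_ Hx]. rewrite slope_diag. unfold slope. simpl in x.
change (Rabs (x - x0) < delta) in Hx.
change (Rabs ((if Req_EM_T x x0 then d else (f x - f x0) / (x - x0)) - d) < eps).
destruct (Req_EM_T x x0) as [->|H].
- rewrite (Rminus_diag_eq d d eq_refl), Rabs_R0. exact He.
- specialize (Hdelta (x - x0) ltac:(lra) Hx).
  now rewrite Rplus_minus in Hdelta.
Qed.

(** * The adoption rate *)

Lemma adoption_rate_bounds (p q F pi : R) : 0 < adoption_rate p q F pi < 1.
Proof.
unfold adoption_rate. pose proof (exp_pos (p + q * F - pi)) as H.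
split.
- apply Rdiv_lt_0_compat; lra.
- apply Rlt_div_l; lra.
Qed.

Lemma adoption_rate_decreasing (p q F x y : R) :
  x < y -> adoption_rate p q F y < adoption_rate p q F x.
Proof.
intros H. unfold adoption_rate.
pose proof (exp_pos (p + q * F - x)). pose proof (exp_pos (p + q * F - y)).
assert (exp (p + q * F - y) < exp (p + q * F - x)) by (apply exp_increasing; lra).
apply Rlt_0_minus.
replace (_ - _) with
  ((exp (p + q * F - x) - exp (p + q * F - y))
   / ((1 + exp (p + q * F - x)) * (1 + exp (p + q * F - y)))) by (field; lra).
apply Rdiv_lt_0_compat; [lra|apply Rmult_lt_0_compat; lra].
Qed.

(** The odds of the logistic rate; the first-order condition thereby becomes rational in R. *)
Lemma exp_adoption_rate (p q F pi : R) :
  exp (p + q * F - pi) = adoption_rate p q F pi / (1 - adoption_rate p q F pi).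
Proof.
unfold adoption_rate. pose proof (exp_pos (p + q * F - pi)).
field. split; [lra|]. replace (1 + _ - _) with 1 by ring. lra.
Qed.

Lemma is_derive_adoption_rate (p q : R) (f : R -> R) (F d : R) :
  is_derive f F d ->
  is_derive (fun x => adoption_rate p q x (f x)) F
    (adoption_rate p q F (f F) * (1 - adoption_rate p q F (f F)) * (q - d)).
Proof.
intros Hf. unfold adoption_rate. pose proof (exp_pos (p + q * F + - f F)).
auto_derive.
- repeat split; [now exists d|now exists d|lra].
- change (Derive (fun x => f x) F) with (Derive f F).
  rewrite (is_derive_unique _ _ _ Hf).
  unfold Rminus in *. field. lra.
Qed.

Lemma is_derive_adoption_rate_price (p q F pi : R) :
  is_derive (adoption_rate p q F) pi
    (- (adoption_rate p q F pi * (1 - adoption_rate p q F pi))).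
Proof.
unfold adoption_rate. pose proof (exp_pos (p + q * F + - pi)).
auto_derive; unfold Rminus in *.
- lra.
- field. lra.
Qed.

Lemma next_fraction_bounds (p q F pi : R) :
  F < 1 -> F < next_fraction p q F pi < 1.
Proof.
intros H. unfold next_fraction.
pose proof (adoption_rate_bounds p q F pi). nra.
Qed.

Lemma is_derive_next_fraction_price (p q F pi : R) :
  is_derive (next_fraction p q F) pi
    (- ((1 - F) * (adoption_rate p q F pi * (1 - adoption_rate p q F pi)))).
Proof.
unfold next_fraction.
pose proof (is_derive_adoption_rate_price p q F pi) as H.
auto_derive.
- now eexists; apply H.
- change (Derive (fun x => adoption_rate p q F x) pi)
    with (Derive (adoption_rate p q F) pi).
  rewrite (is_derive_unique _ _ _ H). ring.
Qed.

(** * The first-order condition *)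

(* Up to the factor - (1 - F) R (1 - R), [foc] is the derivative in pi of the
   state-action value; [w] stands for the derivative of the continuation value. *)
Definition foc (p q C : R) (w : R -> R) (F pi : R) : R :=
  pi - C - 1 - exp (p + q * F - pi) + w (next_fraction p q F pi).

(** The invariant of the backward induction. The open interval suffices because from F in [0,1) the
    next fraction lies strictly between F and 1. *)
Definition regular_slope (w : R -> R) : Prop :=
  forall F, 0 < F < 1 -> w F <= 0 /\ exists d, is_derive w F d /\ d <= 0.

Definition value_slope (W w : R -> R) : Prop :=
  forall F, 0 < F < 1 -> is_derive W F (w F).

(* The envelope formula for the derivative of the optimal value. *)
Definition slope_step (p q C : R) (pi : R -> R) (F : R) : R :=
  1 + C - pi F + q * (1 - F) * adoption_rate p q F (pi F).

Lemma regular_slope_nonincreasing (w : R -> R) (x y : R) :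
  regular_slope w -> 0 < x -> x <= y -> y < 1 -> w y <= w x.
Proof.
intros Hw Hx Hxy Hy.
apply nonincreasing_of_derive with (df := Derive w); [easy|].
intros z Hz. destruct (Hw z ltac:(lra)) as [_ [d [Hd Hd0]]].
rewrite (is_derive_unique _ _ _ Hd). now split.
Qed.

(** A higher price lowers both the exponential and the next fraction, and [w] is nonincreasing, so
    the other terms can only add to [y - x]. Sign, continuity and comparison of roots all come from
    this bound. *)
Lemma foc_expanding (p q C : R) (w : R -> R) (F x y : R) :
  regular_slope w -> 0 <= F < 1 -> x <= y ->
  y - x <= foc p q C w F y - foc p q C w F x.
Proof.
intros Hw HF [Hxy| ->]; [|lra].
unfold foc.
assert (exp (p + q * F - y) < exp (p + q * F - x)) by (apply exp_increasing; lra).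
assert (w (next_fraction p q F x) <= w (next_fraction p q F y)); [|lra].
pose proof (next_fraction_bounds p q F x ltac:(lra)).
pose proof (next_fraction_bounds p q F y ltac:(lra)).
apply regular_slope_nonincreasing; try lra; [easy|].
unfold next_fraction.
pose proof (adoption_rate_decreasing p q F x y Hxy). nra.
Qed.

Lemma foc_continuous_price (p q C : R) (w : R -> R) (F pi : R) :
  regular_slope w -> 0 <= F < 1 -> continuity_pt (foc p q C w F) pi.
Proof.
intros Hw HF.
apply derivable_continuous_pt, ex_derive_Reals_0.
destruct (Hw (next_fraction p q F pi)) as [_ [d [Hd _]]].
{ pose proof (next_fraction_bounds p q F pi); lra. }
unfold foc. auto_derive. repeat split.
- now exists d.
- eexists. apply is_derive_next_fraction_price.
Qed.

Lemma foc_continuous_state (p q C : R) (w : R -> R) (F pi : R) :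
  regular_slope w -> 0 <= F < 1 -> continuous (fun x => foc p q C w x pi) F.
Proof.
intros Hw HF.
apply (ex_derive_continuous (fun x => foc p q C w x pi)).
destruct (Hw (next_fraction p q F pi)) as [_ [d [Hd _]]].
{ pose proof (next_fraction_bounds p q F pi); lra. }
unfold foc. auto_derive. repeat split.
- now exists d.
- unfold next_fraction.
  pose proof (is_derive_adoption_rate p q (fun _ => pi) F 0) as H.
  specialize (H (is_derive_const _ _)).
  auto_derive. eexists; apply H.
Qed.

Lemma foc_root (p q C : R) (w : R -> R) (F : R) :
  0 <= p -> 0 <= q -> 0 <= C -> regular_slope w -> 0 <= F < 1 ->
  exists pi, 0 < pi /\ foc p q C w F pi = 0.
Proof.
intros hp hq hC Hw HF.
assert (H0 : foc p q C w F 0 < 0).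
{ unfold foc. pose proof (exp_pos (p + q * F - 0)).
  destruct (Hw (next_fraction p q F 0)) as [Hle _].
  { pose proof (next_fraction_bounds p q F 0); lra. }
  lra. }
(* The next fraction equals [m] at rate 1/2. Any price above [p + q * F] has rate below 1/2, so
   [w m] bounds [w] from below there, independently of the price. *)
set (m := (1 + F) / 2).
assert (Hm : w m <= 0) by (apply Hw; unfold m; lra).
(* Chosen so that [b - C - 1 + w m] is [1 + (p + q * F)], at least 1, while the exponential at [b]
   is below 1. *)
set (b := C + 2 + (p + q * F) - w m).
assert (Hu : 0 <= p + q * F) by nra.
assert (Hb : 0 < foc p q C w F b).
{ assert (He : exp (p + q * F - b) < 1).
  { rewrite <- exp_0. apply exp_increasing. unfold b. lra. }
  assert (w m <= w (next_fraction p q F b)).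
  { pose proof (next_fraction_bounds p q F b ltac:(lra)) as Hn.
    apply regular_slope_nonincreasing; [easy|lra| |unfold m; lra].
    assert (adoption_rate p q F b <= / 2); [|unfold next_fraction, m; nra].
    unfold adoption_rate. pose proof (exp_pos (p + q * F - b)).
    apply Rle_div_l; lra. }
  assert (b - C - 2 + w m = p + q * F) by (unfold b; ring).
  unfold foc. lra. }
destruct (IVT (foc p q C w F) 0 b) as [z [Hz Hz0]].
- intros x. now apply foc_continuous_price.
- unfold b. lra.
- easy.
- easy.
- exists z. split; [|easy].
  destruct (Rle_lt_or_eq_dec 0 z (proj1 Hz)) as [|<-]; lra.
Qed.

(** * Optimality of the root *)

Definition state_action_value (p q C : R) (W : R -> R) (F pi : R) : R :=
  stage_profit p q C F pi + W (next_fraction p q F pi).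

Lemma is_derive_state_action_value (p q C : R) (W w : R -> R) (F pi : R) :
  value_slope W w -> 0 <= F < 1 ->
  is_derive (state_action_value p q C W F) pi
    (- ((1 - F) * (adoption_rate p q F pi * (1 - adoption_rate p q F pi))
        * foc p q C w F pi)).
Proof.
intros HW HF.
pose proof (is_derive_adoption_rate_price p q F pi) as HR.
pose proof (is_derive_next_fraction_price p q F pi) as HN.
specialize (HW (next_fraction p q F pi)).
assert (Hv : is_derive W (next_fraction p q F pi) (w (next_fraction p q F pi))).
{ apply HW. pose proof (next_fraction_bounds p q F pi); lra. }
unfold state_action_value, stage_profit. auto_derive.
- repeat split; now eexists; eauto.
- change (Derive (fun x => adoption_rate p q F x) pi)
    with (Derive (adoption_rate p q F) pi).
  change (Derive (fun x => next_fraction p q F x) pi)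
    with (Derive (next_fraction p q F) pi).
  change (Derive (fun x => W x)) with (Derive W).
  rewrite (is_derive_unique _ _ _ HR), (is_derive_unique _ _ _ HN),
    (is_derive_unique _ _ _ Hv).
  unfold foc. rewrite exp_adoption_rate.
  pose proof (adoption_rate_bounds p q F pi). field. lra.
Qed.

(** By expansion, [foc] is negative to the left of its root and positive to the right; the value has
    a derivative of opposite sign, so it strictly rises up to [pi] and strictly falls afterwards. *)
Lemma foc_root_strict_max (p q C : R) (W w : R -> R) (F pi x : R) :
  regular_slope w -> value_slope W w -> 0 <= F < 1 ->
  foc p q C w F pi = 0 -> x <> pi ->
  state_action_value p q C W F x < state_action_value p q C W F pi.
Proof.
intros Hw HW HF Hpi Hx.
set (df := fun y =>
  - ((1 - F) * (adoption_rate p q F y * (1 - adoption_rate p q F y))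
     * foc p q C w F y)).
assert (Hd : forall c,
  derivable_pt_lim (state_action_value p q C W F) c (df c)).
{ intros c. apply is_derive_Reals. now apply is_derive_state_action_value. }
assert (Hk : forall c,
  0 < (1 - F) * (adoption_rate p q F c * (1 - adoption_rate p q F c))).
{ intros c. pose proof (adoption_rate_bounds p q F c).
  apply Rmult_lt_0_compat; [lra|apply Rmult_lt_0_compat; lra]. }
destruct (Rtotal_order x pi) as [Hlt|[Heq|Hlt]]; [|easy|].
- destruct (MVT_cor2 _ df x pi Hlt (fun c _ => Hd c)) as [c [He Hc]].
  pose proof (foc_expanding p q C w F c pi Hw HF ltac:(lra)).
  assert (0 < df c); [|nra].
  unfold df. specialize (Hk c). nra.
- destruct (MVT_cor2 _ df pi x Hlt (fun c _ => Hd c)) as [c [He Hc]].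
  pose proof (foc_expanding p q C w F pi c Hw HF ltac:(lra)).
  assert (df c < 0); [|nra].
  unfold df. specialize (Hk c). nra.
Qed.

(** * Differentiability of the optimal price *)

(** Caratheodory's criterion relative to [D]: the factorization is required on [D] only, but [g]
    must be continuous from both sides. At the left end of [0,1) this calls for an extension of the
    price beyond 0. *)
Lemma D_in_of_slope (f d g : R -> R) (D : R -> Prop) (x0 : R) :
  (forall x, D x -> f x - f x0 = g x * (x - x0)) ->
  continuity_pt g x0 -> d x0 = g x0 -> D_in f d D x0.
Proof.
intros Hf Hg Hd eps He.
destruct (Hg eps He) as [delta [Hdelta H]].
exists delta. split; [easy|].
intros x [[HD Hne] Hx].
rewrite Hf, Hd by easy.
replace (g x * (x - x0) / (x - x0)) with (g x) by (field; lra).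
apply H. repeat split; auto.
Qed.

Lemma D_in_is_derive (f d : R -> R) (D : R -> Prop) (x0 : R) :
  D_in f d D x0 -> locally x0 D -> is_derive f x0 (d x0).
Proof.
intros Hf [r Hr]. apply is_derive_Reals.
intros eps He. destruct (Hf eps He) as [delta [Hdelta H]].
exists (mkposreal (Rmin r delta) (Rmin_pos _ _ (cond_pos r) Hdelta)).
intros h Hh Hlt. simpl in Hlt.
pose proof (Rmin_l r delta). pose proof (Rmin_r r delta).
specialize (H (x0 + h)).
replace (x0 + h - x0) with h in H by ring.
apply H. split.
- split; [|lra]. apply Hr. change (Rabs (x0 + h - x0) < r).
  replace (x0 + h - x0) with h by ring. lra.
- simpl. unfold Rdist. replace (x0 + h - x0) with h by ring. lra.
Qed.

(** The reflection [Rabs] extends the price evenly below 0, giving two-sided continuity at 0. By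
    expansion, the distance from [pi x] to [pi F] is at most the absolute value of [foc] at state x
    and price [pi F], which tends to 0 as x tends to F. *)
Lemma root_continuous (p q C : R) (w pi : R -> R) (F : R) :
  regular_slope w ->
  (forall x, 0 <= x < 1 -> foc p q C w x (pi x) = 0) ->
  0 <= F < 1 -> continuous (fun x => pi (Rabs x)) F.
Proof.
intros Hw Hpi HF.
assert (HaF : Rabs F = F) by (apply Rabs_pos_eq; lra).
assert (Hc : continuous (fun x => foc p q C w (Rabs x) (pi F)) F).
{ apply (continuous_comp Rabs (fun y => foc p q C w y (pi F))).
  - apply continuous_Rabs.
  - rewrite HaF. now apply foc_continuous_state. }
apply filterlim_locally. intros eps.
pose proof (proj1 (filterlim_locally _ _) Hc eps) as Hl.
assert (H1 : locally F (fun x => -1 < x < 1)).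
{ apply (open_and (fun x => -1 < x) (fun x => x < 1));
    [apply open_gt|apply open_lt|lra]. }
refine (filter_imp _ _ _ (filter_and _ _ Hl H1)).
intros x [Hx Hx1].
change (Rabs (foc p q C w (Rabs x) (pi F) - foc p q C w (Rabs F) (pi F)) < eps) in Hx.
change (Rabs (pi (Rabs x) - pi (Rabs F)) < eps).
rewrite HaF in Hx |- *.
assert (Hax : 0 <= Rabs x < 1).
{ split; [apply Rabs_pos|apply Rabs_def1; lra]. }
rewrite (Hpi F HF), Rminus_0_r in Hx.
pose proof (Hpi _ Hax) as H0.
apply Rabs_def2 in Hx.
destruct (Rle_or_lt (pi (Rabs x)) (pi F)) as [Hle|Hlt].
- pose proof (foc_expanding p q C w _ _ _ Hw Hax Hle).
  apply Rabs_def1; lra.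
- pose proof (foc_expanding p q C w _ _ _ Hw Hax (Rlt_le _ _ Hlt)).
  apply Rabs_def1; lra.
Qed.

(** * Secant slopes of the implicitly defined price *)

Definition exp_slope (p q F pi x y : R) : R :=
  slope exp (exp (p + q * F - pi)) (p + q * F - pi) (p + q * x - y).

(** Secant slope of the logistic function, from e^u/(1+e^u) - e^v/(1+e^v) = (e^u -
    e^v)/((1+e^u)(1+e^v)). *)
Definition rate_slope (p q F pi x y : R) : R :=
  exp_slope p q F pi x y
  / ((1 + exp (p + q * x - y)) * (1 + exp (p + q * F - pi))).

Definition next_slope (p q : R) (w : R -> R) (F pi x y : R) : R :=
  slope w (Derive w (next_fraction p q F pi))
    (next_fraction p q F pi) (next_fraction p q x y).

(* Obtained by factoring each difference in [foc x y - foc F pi = 0] through a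
   slope function and solving for [(y - pi) / (x - F)]. *)
Definition price_slope (p q : R) (w : R -> R) (F pi x y : R) : R :=
  (q * exp_slope p q F pi x y
   - next_slope p q w F pi x y
     * (1 - adoption_rate p q x y + (1 - F) * (rate_slope p q F pi x y * q)))
  / (1 + exp_slope p q F pi x y
     - next_slope p q w F pi x y * ((1 - F) * rate_slope p q F pi x y)).

Lemma slope_nonpos (f : R -> R) (d x0 x : R) :
  d <= 0 -> (f x - f x0) * (x - x0) <= 0 -> slope f d x0 x <= 0.
Proof.
intros Hd Hf. rewrite (slope_spec f d x0 x) in Hf.
destruct (Req_EM_T x x0) as [->|Hne]; [now rewrite slope_diag|].
assert (0 < (x - x0) * (x - x0)) by nra. nra.
Qed.

Lemma exp_slope_pos (p q F pi x y : R) : 0 < exp_slope p q F pi x y.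
Proof.
unfold exp_slope.
set (u := p + q * x - y). set (v := p + q * F - pi).
pose proof (slope_spec exp (exp v) v u) as H.
destruct (Rtotal_order u v) as [Hlt|[->|Hlt]].
- pose proof (exp_increasing _ _ Hlt). nra.
- rewrite slope_diag. apply exp_pos.
- pose proof (exp_increasing _ _ Hlt). nra.
Qed.

Lemma rate_slope_pos (p q F pi x y : R) : 0 < rate_slope p q F pi x y.
Proof.
unfold rate_slope. pose proof (exp_slope_pos p q F pi x y).
pose proof (exp_pos (p + q * x - y)). pose proof (exp_pos (p + q * F - pi)).
apply Rdiv_lt_0_compat; nra.
Qed.

Lemma rate_slope_spec (p q F pi x y : R) :
  adoption_rate p q x y - adoption_rate p q F pi
  = rate_slope p q F pi x y * (q * (x - F) - (y - pi)).
Proof.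
unfold rate_slope, adoption_rate.
pose proof (exp_pos (p + q * x - y)). pose proof (exp_pos (p + q * F - pi)).
pose proof (slope_spec exp (exp (p + q * F - pi))
  (p + q * F - pi) (p + q * x - y)) as H1.
fold (exp_slope p q F pi x y) in H1.
replace (p + q * x - y - (p + q * F - pi))
  with (q * (x - F) - (y - pi)) in H1 by ring.
transitivity ((exp (p + q * x - y) - exp (p + q * F - pi))
  / ((1 + exp (p + q * x - y)) * (1 + exp (p + q * F - pi)))).
- field; lra.
- rewrite H1. field; lra.
Qed.

Lemma next_slope_nonpos (p q : R) (w : R -> R) (F pi x y : R) :
  regular_slope w -> 0 <= F < 1 -> 0 <= x < 1 ->
  next_slope p q w F pi x y <= 0.
Proof.
intros Hw HF Hx.
pose proof (next_fraction_bounds p q F pi ltac:(lra)).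
pose proof (next_fraction_bounds p q x y ltac:(lra)).
apply slope_nonpos.
- destruct (Hw (next_fraction p q F pi) ltac:(lra)) as [_ [d [Hd Hd0]]].
  now rewrite (is_derive_unique _ _ _ Hd).
- pose proof (fun u v => regular_slope_nonincreasing w u v Hw) as Hmono.
  destruct (Rle_or_lt (next_fraction p q F pi) (next_fraction p q x y)) as [Hle|Hlt].
  + specialize (Hmono (next_fraction p q F pi) (next_fraction p q x y)). nra.
  + specialize (Hmono (next_fraction p q x y) (next_fraction p q F pi)). nra.
Qed.

(** The secant counterpart of the slope of [foc] in the price: the exponential and rate slopes are
    positive and the slope of [w] is nonpositive, so nothing is subtracted from 1. *)
Lemma price_slope_denominator (p q : R) (w : R -> R) (F pi x y : R) :
  regular_slope w -> 0 <= F < 1 -> 0 <= x < 1 ->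
  0 < 1 + exp_slope p q F pi x y
      - next_slope p q w F pi x y * ((1 - F) * rate_slope p q F pi x y).
Proof.
intros Hw HF Hx.
pose proof (exp_slope_pos p q F pi x y).
pose proof (next_slope_nonpos p q w F pi x y Hw HF Hx).
pose proof (rate_slope_pos p q F pi x y).
assert (0 < (1 - F) * rate_slope p q F pi x y) by (apply Rmult_lt_0_compat; lra).
nra.
Qed.

Lemma price_slope_nonneg (p q : R) (w : R -> R) (F pi x y : R) :
  0 <= q -> regular_slope w -> 0 <= F < 1 -> 0 <= x < 1 ->
  0 <= price_slope p q w F pi x y.
Proof.
intros hq Hw HF Hx. unfold price_slope.
apply Rdiv_le_0_compat; [|now apply price_slope_denominator].
pose proof (exp_slope_pos p q F pi x y).
pose proof (next_slope_nonpos p q w F pi x y Hw HF Hx).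
pose proof (rate_slope_pos p q F pi x y).
pose proof (adoption_rate_bounds p q x y).
assert (0 <= (1 - F) * (rate_slope p q F pi x y * q)).
{ apply Rmult_le_pos; [lra|apply Rmult_le_pos; lra]. }
nra.
Qed.

Lemma price_slope_spec (p q C : R) (w : R -> R) (F pi x y : R) :
  regular_slope w -> 0 <= F < 1 -> 0 <= x < 1 ->
  foc p q C w F pi = 0 -> foc p q C w x y = 0 ->
  y - pi = price_slope p q w F pi x y * (x - F).
Proof.
intros Hw HF Hx H0 H1.
pose proof (price_slope_denominator p q w F pi x y Hw HF Hx) as HD.
unfold price_slope.
pose proof (slope_spec exp (exp (p + q * F - pi))
  (p + q * F - pi) (p + q * x - y)) as He.
fold (exp_slope p q F pi x y) in He.
pose proof (slope_spec w (Derive w (next_fraction p q F pi))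
    (next_fraction p q F pi) (next_fraction p q x y)) as Hn.
fold (next_slope p q w F pi x y) in Hn.
pose proof (rate_slope_spec p q F pi x y) as Hr.
(* Splits the difference of products into a change of state at the rate of [(x, y)] and a change of
   rate at the state [F]. *)
assert (Hnext : next_fraction p q x y - next_fraction p q F pi
  = (x - F) * (1 - adoption_rate p q x y)
    + (1 - F) * (rate_slope p q F pi x y * (q * (x - F) - (y - pi)))).
{ rewrite <- Hr. unfold next_fraction. ring. }
rewrite Hnext in Hn. unfold foc in H0, H1.
set (D := 1 + _ - _) in *.
(* Subtracting the two root equations gives [(y - pi) * D] = numerator times [(x - F)]; [D] is
   positive. *)
apply Rmult_eq_reg_r with D; [|lra].
transitivity ((q * exp_slope p q F pi x y
   - next_slope p q w F pi x y
     * (1 - adoption_rate p q x y + (1 - F) * (rate_slope p q F pi x y * q)))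
  * (x - F)); [|field; lra].
unfold D. clear Hr Hnext HD D. nra.
Qed.

(** The slopes of [exp] and [w] are continuous at their base points by differentiability there; the
    rest is composition and arithmetic with a nonzero denominator. *)
Lemma price_slope_continuous (p q : R) (w P : R -> R) (F : R) :
  regular_slope w -> 0 <= F < 1 -> continuity_pt P F ->
  continuity_pt (fun x => price_slope p q w F (P F) x (P x)) F.
Proof.
intros Hw HF HP.
assert (Hid : continuity_pt (fun x => x) F) by apply continuity_pt_id.
assert (Hcst : forall c, continuity_pt (fun _ : R => c) F).
{ intros c. now apply continuity_pt_const. }
assert (Hu : continuity_pt (fun x => p + q * x - P x) F).
{ apply (continuity_pt_minus (fun x => p + q * x) P); [|easy].
  apply (continuity_pt_plus (fun _ => p) (fun x => q * x)); [easy|].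
  now apply (continuity_pt_mult (fun _ => q) (fun x => x)). }
assert (Hexp : continuity_pt (fun x => exp (p + q * x - P x)) F).
{ apply (continuity_pt_comp (fun x => p + q * x - P x) exp); [easy|].
  apply derivable_continuous_pt, derivable_pt_exp. }
assert (H1exp : continuity_pt (fun x => 1 + exp (p + q * x - P x)) F).
{ now apply (continuity_pt_plus (fun _ => 1)). }
assert (Hrate : continuity_pt (fun x => adoption_rate p q x (P x)) F).
{ unfold adoption_rate.
  apply (continuity_pt_div (fun x => exp (p + q * x - P x))
    (fun x => 1 + exp (p + q * x - P x))); [easy|easy|].
  pose proof (exp_pos (p + q * F - P F)). lra. }
assert (Hnext : continuity_pt (fun x => next_fraction p q x (P x)) F).
{ unfold next_fraction.
  apply (continuity_pt_plus (fun x => x)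
    (fun x => (1 - x) * adoption_rate p q x (P x))); [easy|].
  apply (continuity_pt_mult (fun x => 1 - x)
    (fun x => adoption_rate p q x (P x))); [|easy].
  now apply (continuity_pt_minus (fun _ => 1) (fun x => x)). }
assert (Hes : continuity_pt (fun x => exp_slope p q F (P F) x (P x)) F).
{ unfold exp_slope.
  apply (continuity_pt_comp (fun x => p + q * x - P x)
    (slope exp (exp (p + q * F - P F)) (p + q * F - P F))); [easy|].
  apply continuity_pt_filterlim, slope_continuous, is_derive_Reals.
  apply derivable_pt_lim_exp. }
assert (Hrs : continuity_pt (fun x => rate_slope p q F (P F) x (P x)) F).
{ unfold rate_slope.
  apply (continuity_pt_div (fun x => exp_slope p q F (P F) x (P x))
    (fun x => (1 + exp (p + q * x - P x)) * (1 + exp (p + q * F - P F))));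
    [easy| |].
  - now apply (continuity_pt_mult (fun x => 1 + exp (p + q * x - P x))
      (fun _ => 1 + exp (p + q * F - P F))).
  - pose proof (exp_pos (p + q * F - P F)). nra. }
assert (Hns : continuity_pt (fun x => next_slope p q w F (P F) x (P x)) F).
{ unfold next_slope.
  apply (continuity_pt_comp (fun x => next_fraction p q x (P x))
    (slope w (Derive w (next_fraction p q F (P F)))
       (next_fraction p q F (P F)))); [easy|].
  apply continuity_pt_filterlim, slope_continuous, Derive_correct.
  destruct (Hw (next_fraction p q F (P F))) as [_ [d [Hd _]]].
  { pose proof (next_fraction_bounds p q F (P F)); lra. }
  now exists d. }
unfold price_slope.
apply (continuity_pt_div
  (fun x => q * exp_slope p q F (P F) x (P x)
   - next_slope p q w F (P F) x (P x)
     * (1 - adoption_rate p q x (P x)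
        + (1 - F) * (rate_slope p q F (P F) x (P x) * q)))
  (fun x => 1 + exp_slope p q F (P F) x (P x)
     - next_slope p q w F (P F) x (P x)
       * ((1 - F) * rate_slope p q F (P F) x (P x)))).
- apply (continuity_pt_minus (fun x => q * exp_slope p q F (P F) x (P x))
    (fun x => next_slope p q w F (P F) x (P x)
     * (1 - adoption_rate p q x (P x)
        + (1 - F) * (rate_slope p q F (P F) x (P x) * q)))).
  { now apply (continuity_pt_mult (fun _ => q)). }
  apply (continuity_pt_mult (fun x => next_slope p q w F (P F) x (P x))
    (fun x => 1 - adoption_rate p q x (P x)
        + (1 - F) * (rate_slope p q F (P F) x (P x) * q))); [easy|].
  apply (continuity_pt_plus (fun x => 1 - adoption_rate p q x (P x))
    (fun x => (1 - F) * (rate_slope p q F (P F) x (P x) * q))).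
  { now apply (continuity_pt_minus (fun _ => 1)). }
  apply (continuity_pt_mult (fun _ => 1 - F)
    (fun x => rate_slope p q F (P F) x (P x) * q)); [easy|].
  now apply (continuity_pt_mult
    (fun x => rate_slope p q F (P F) x (P x)) (fun _ => q)).
- apply (continuity_pt_minus (fun x => 1 + exp_slope p q F (P F) x (P x))
    (fun x => next_slope p q w F (P F) x (P x)
       * ((1 - F) * rate_slope p q F (P F) x (P x)))).
  { now apply (continuity_pt_plus (fun _ => 1)). }
  apply (continuity_pt_mult (fun x => next_slope p q w F (P F) x (P x))
    (fun x => (1 - F) * rate_slope p q F (P F) x (P x))); [easy|].
  now apply (continuity_pt_mult (fun _ => 1 - F)).
- apply Rgt_not_eq. now apply price_slope_denominator.
Qed.

Lemma root_D_in (p q C : R) (w pi : R -> R) (F : R) :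
  regular_slope w ->
  (forall x, 0 <= x < 1 -> foc p q C w x (pi x) = 0) -> 0 <= F < 1 ->
  D_in pi (fun x => price_slope p q w x (pi x) x (pi x))
    (fun x => 0 <= x < 1) F.
Proof.
intros Hw Hpi HF.
assert (HaF : Rabs F = F) by (apply Rabs_pos_eq; lra).
(* The reflected price agrees with [pi] on [0,1) and makes the slope continuous from both sides. *)
apply D_in_of_slope
  with (g := fun x => price_slope p q w F (pi F) x (pi (Rabs x))).
- intros x Hx. rewrite (Rabs_pos_eq x) by lra.
  apply (price_slope_spec p q C); auto.
- pose proof (price_slope_continuous p q w (fun x => pi (Rabs x)) F Hw HF) as H.
  cbv beta in H. rewrite HaF in H. apply H.
  apply continuity_pt_filterlim. now apply (root_continuous p q C w).
- cbv beta. now rewrite HaF.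
Qed.

Lemma root_derive (p q C : R) (w pi : R -> R) (F : R) :
  0 <= q -> regular_slope w ->
  (forall x, 0 <= x < 1 -> foc p q C w x (pi x) = 0) -> 0 < F < 1 ->
  exists d, is_derive pi F d /\ 0 <= d.
Proof.
intros hq Hw Hpi HF.
exists (price_slope p q w F (pi F) F (pi F)). split.
- apply (D_in_is_derive pi (fun x => price_slope p q w x (pi x) x (pi x))
    (fun x => 0 <= x < 1)).
  + apply (root_D_in p q C); auto; lra.
  + apply (filter_imp (fun x => 0 < x < 1)); [intros x; lra|].
    apply (open_and (fun x => 0 < x) (fun x => x < 1));
      [apply open_gt|apply open_lt|lra].
- apply price_slope_nonneg; auto; lra.
Qed.

(** * Backward induction *)

Lemma slope_step_regular (p q C : R) (w pi : R -> R) :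
  0 <= q <= 1 -> regular_slope w ->
  (forall x, 0 <= x < 1 -> foc p q C w x (pi x) = 0) ->
  regular_slope (slope_step p q C pi).
Proof.
intros hq Hw Hpi F HF.
destruct (root_derive p q C w pi F ltac:(lra) Hw Hpi HF) as [d [Hd Hd0]].
pose proof (is_derive_adoption_rate p q pi F d Hd) as HR.
pose proof (adoption_rate_bounds p q F (pi F)) as Hr.
unfold slope_step. split.
(* Since [w <= 0], the root equation gives pi - C - 1 >= r/(1-r) >= r, which dominates q(1-F)r. *)
- specialize (Hpi F ltac:(lra)). unfold foc in Hpi.
  rewrite exp_adoption_rate in Hpi.
  destruct (Hw (next_fraction p q F (pi F))) as [Hle _].
  { pose proof (next_fraction_bounds p q F (pi F)); lra. }
  set (r := adoption_rate p q F (pi F)) in *. clearbody r.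
  assert (r <= r / (1 - r)) by (apply Rle_div_r; nra).
  assert (q * (1 - F) <= 1) by nra.
  nra.
- exists (- d + q * (- adoption_rate p q F (pi F) + (1 - F) *
    (adoption_rate p q F (pi F) * (1 - adoption_rate p q F (pi F)) * (q - d)))).
  split.
  + assert (Hg : forall (r : R -> R) (e : R), is_derive r F e ->
      is_derive (fun x => 1 + C - pi x + q * (1 - x) * r x) F
        (- d + q * (- r F + (1 - F) * e))).
    { intros r e Hre. auto_derive.
      - repeat split; [now exists d|now exists e].
      - change (Derive (fun x => pi x)) with (Derive pi).
        change (Derive (fun x => r x)) with (Derive r).
        rewrite (is_derive_unique _ _ _ Hd), (is_derive_unique _ _ _ Hre). ring. }
    exact (Hg _ _ HR).
  + set (r := adoption_rate p q F (pi F)) in *.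
    assert (0 <= (1 - F) * (1 - r) <= 1) by nra.
    (* Here [q <= 1] enters: as [d >= 0], the factor [q - d] is at most 1, and so is its product
       with (1-F)(1-r). *)
    assert ((1 - F) * (r * (1 - r) * (q - d)) <= r); [|nra].
    replace ((1 - F) * (r * (1 - r) * (q - d)))
      with (r * ((1 - F) * (1 - r) * (q - d))) by ring.
    assert ((1 - F) * (1 - r) * (q - d) <= 1); nra.
Qed.

(** The envelope argument: the chain rule along the optimal price produces terms in its derivative
    [d], and these cancel once the root equation is solved for [w] at the next fraction. *)
Lemma slope_step_value (p q C : R) (W w pi : R -> R) (V1 : R -> R) :
  0 <= q -> regular_slope w -> value_slope W w ->
  (forall x, 0 <= x < 1 -> foc p q C w x (pi x) = 0) ->
  (forall x, 0 <= x < 1 -> V1 x = state_action_value p q C W x (pi x)) ->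
  value_slope V1 (slope_step p q C pi).
Proof.
intros hq Hw HW Hpi HV F HF.
destruct (root_derive p q C w pi F hq Hw Hpi HF) as [d [Hd _]].
pose proof (is_derive_adoption_rate p q pi F d Hd) as HR.
pose proof (adoption_rate_bounds p q F (pi F)) as Hr.
apply (is_derive_ext_loc (fun x => state_action_value p q C W x (pi x))).
{ apply (filter_imp (fun x => 0 < x < 1)); [intros x Hx; symmetry; apply HV; lra|].
  apply (open_and (fun x => 0 < x) (fun x => x < 1));
    [apply open_gt|apply open_lt|lra]. }
assert (Hv : is_derive W (next_fraction p q F (pi F))
  (w (next_fraction p q F (pi F)))).
{ apply HW. pose proof (next_fraction_bounds p q F (pi F)); lra. }
specialize (Hpi F ltac:(lra)). unfold foc in Hpi.
rewrite exp_adoption_rate in Hpi.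
assert (Hg : forall (r : R -> R) (e v : R), is_derive r F e ->
  is_derive W (F + (1 - F) * r F) v ->
  is_derive (fun x => (pi x - C) * (1 - x) * r x + W (x + (1 - x) * r x)) F
    ((d * (1 - F) - (pi F - C)) * r F + (pi F - C) * (1 - F) * e
     + (1 - r F + (1 - F) * e) * v)).
{ intros r e v Hre Hwv. auto_derive.
  - repeat split; try (now exists d); try (now exists e). now exists v.
  - change (Derive (fun x => pi x)) with (Derive pi).
    change (Derive (fun x => r x)) with (Derive r).
    change (Derive (fun x => W x)) with (Derive W).
    rewrite (is_derive_unique _ _ _ Hd), (is_derive_unique _ _ _ Hre).
    replace (1 + - F) with (1 - F) by ring.
    rewrite (is_derive_unique _ _ _ Hwv). ring. }
specialize (Hg _ _ _ HR Hv). cbv beta in Hg.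
unfold state_action_value, stage_profit, next_fraction in *.
set (r := adoption_rate p q F (pi F)) in *.
replace (w (F + (1 - F) * r)) with (1 + C - pi F + r / (1 - r)) in Hg by lra.
replace (slope_step p q C pi F) with
  ((d * (1 - F) - (pi F - C)) * r + (pi F - C) * (1 - F) * (r * (1 - r) * (q - d))
   + (1 - r + (1 - F) * (r * (1 - r) * (q - d))) * (1 + C - pi F + r / (1 - r))).
{ exact Hg. }
unfold slope_step. fold r. field. lra.
Qed.

(** Zero value after the horizon makes the last period an instance of the general step. *)
Definition continuation (p q C : R) (n : nat) (F : R) : R :=
  match n with
  | O => 0
  | S m => sup_price (Q_remaining p q C m F)
  end.

Definition price (p q C : R) (n : nat) (F : R) : R :=
  argmax_price (Q_remaining p q C n F).

(** The envelope formula taken as an explicit candidate; the induction shows that it is the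
    derivative of [continuation]. *)
Definition continuation_slope (p q C : R) (n : nat) : R -> R :=
  match n with
  | O => fun _ => 0
  | S m => slope_step p q C (price p q C m)
  end.

Lemma Q_remaining_continuation (p q C : R) (n : nat) (F pi : R) :
  Q_remaining p q C n F pi
  = state_action_value p q C (continuation p q C n) F pi.
Proof. destruct n; unfold state_action_value; simpl; [ring|reflexivity]. Qed.

Lemma price_spec (p q C : R) (n : nat) (F : R) :
  0 <= p -> 0 <= q -> 0 <= C -> 0 <= F < 1 ->
  regular_slope (continuation_slope p q C n) ->
  value_slope (continuation p q C n) (continuation_slope p q C n) ->
  unique (fun x => 0 <= x /\
    forall y, 0 <= y -> Q_remaining p q C n F y <= Q_remaining p q C n F x)
    (price p q C n F)
  /\ 0 < price p q C n F
  /\ foc p q C (continuation_slope p q C n) F (price p q C n F) = 0.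
Proof.
intros hp hq hC HF Hw HW.
destruct (foc_root p q C _ F hp hq hC Hw HF) as [x [Hx H0]].
assert (Hm : forall y, y <> x -> Q_remaining p q C n F y < Q_remaining p q C n F x).
{ intros y Hy. rewrite !Q_remaining_continuation.
  now apply (foc_root_strict_max p q C _ (continuation_slope p q C n)). }
assert (Hu : unique (fun x => 0 <= x /\
    forall y, 0 <= y -> Q_remaining p q C n F y <= Q_remaining p q C n F x) x).
{ split.
  - split; [lra|]. intros y _.
    destruct (Req_dec y x) as [->|Hy]; [lra|]. now apply Rlt_le, Hm.
  - intros y [Hy Hmax]. destruct (Req_dec y x) as [->|Hne]; [easy|].
    specialize (Hm y Hne). specialize (Hmax x ltac:(lra)). lra. }
unfold price at 1 2 3. rewrite (argmax_price_unique _ _ Hu). auto.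
Qed.

(** Both properties must be carried together: at stage n they make [price] a root of [foc], and that
    root equation yields both at the next stage. *)
Lemma continuation_regular (p q C : R) (n : nat) :
  0 <= p -> 0 <= q <= 1 -> 0 <= C ->
  regular_slope (continuation_slope p q C n)
  /\ value_slope (continuation p q C n) (continuation_slope p q C n).
Proof.
intros hp hq hC. induction n as [|n [Hw HW]].
- split; intros F HF; simpl; [|exact (is_derive_const (0 : R) F)].
  split; [lra|]. exists 0. split; [exact (is_derive_const (0 : R) F)|lra].
- pose proof (fun F HF => price_spec p q C n F hp (proj1 hq) hC HF Hw HW) as Hp.
  assert (Hfoc : forall x, 0 <= x < 1 ->
    foc p q C (continuation_slope p q C n) x (price p q C n x) = 0).
  { intros x Hx. apply (Hp x Hx). }
  split; simpl.
  + now apply (slope_step_regular p q C (continuation_slope p q C n)).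
  + apply (slope_step_value p q C (continuation p q C n)
      (continuation_slope p q C n)); try easy.
    intros x Hx. rewrite <- Q_remaining_continuation.
    destruct (Hp x Hx) as [[[H1 H2] _] _]. now apply sup_price_max.
Qed.

(** * Monotonicity of the price in time *)

(** If y < x, expansion makes [foc] with [w1] negative at y, and passing to the smaller [w2] keeps
    it negative, so y could not be a root. *)
Lemma foc_root_antitone (p q C : R) (w1 w2 : R -> R) (F x y : R) :
  regular_slope w1 -> (forall z, 0 < z < 1 -> w2 z <= w1 z) -> 0 <= F < 1 ->
  foc p q C w1 F x = 0 -> foc p q C w2 F y = 0 -> x <= y.
Proof.
intros Hw Hle HF Hx Hy.
destruct (Rle_or_lt x y) as [|Hlt]; [easy|].
pose proof (foc_expanding p q C w1 F y x Hw HF ltac:(lra)) as He.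
specialize (Hle (next_fraction p q F y)).
pose proof (next_fraction_bounds p q F y).
unfold foc in Hx, Hy, He. lra.
Qed.

Lemma slope_step_antitone (p q C : R) (pi1 pi2 : R -> R) (F : R) :
  0 <= q -> F < 1 -> pi1 F <= pi2 F ->
  slope_step p q C pi2 F <= slope_step p q C pi1 F.
Proof.
intros hq HF [Hlt|Heq]; unfold slope_step.
- pose proof (adoption_rate_decreasing p q F _ _ Hlt).
  assert (0 <= q * (1 - F)) by nra. nra.
- rewrite Heq. lra.
Qed.

Lemma price_succ (p q C : R) (n : nat) (F : R) :
  0 <= p -> 0 <= q <= 1 -> 0 <= C -> 0 <= F < 1 ->
  price p q C n F <= price p q C (S n) F.
Proof.
intros hp hq hC.
pose proof (fun m => continuation_regular p q C m hp hq hC) as Hreg.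
assert (Hfoc : forall m x, 0 <= x < 1 ->
  foc p q C (continuation_slope p q C m) x (price p q C m x) = 0).
{ intros m x Hx. destruct (Hreg m).
  now apply (price_spec p q C m x hp (proj1 hq) hC Hx). }
revert F. induction n as [|n IH]; intros F HF.
(* In the last period the continuation slope is 0, and the next one is nonpositive by regularity. *)
- apply (foc_root_antitone p q C (continuation_slope p q C 0)
    (continuation_slope p q C 1) F); auto; [apply Hreg|].
  intros z Hz. now apply (Hreg 1%nat).
(* The larger price given by [IH] produces the smaller envelope slope, hence again the larger
   root. *)
- apply (foc_root_antitone p q C (continuation_slope p q C (S n))
    (continuation_slope p q C (S (S n))) F); auto; [apply Hreg|].
  intros z Hz. simpl. apply slope_step_antitone; [lra|lra|].
  apply IH. lra.
Qed.

(* [D_in f f' D x]: f' x is the derivative of f at x relative to D; for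
   D = [0,1) this is the two-sided derivative in (0,1) and the right one at 0. *)
Theorem theorem2 (p q C : R) (T : nat) (hp : 0 <= p) (hq : 0 <= q <= 1)
    (hC : 0 <= C) (hT : (1 <= T)%nat) :
  exists pistar : nat -> R -> R,
    (forall (t : nat) (F : R), (t < T)%nat -> 0 <= F < 1 ->
       unique (optimal_price p q C T t F) (pistar t F))
    /\ (forall (t : nat) (F : R), (t < T)%nat -> 0 <= F < 1 ->
          0 < pistar t F)
    /\ (forall t : nat, (t < T)%nat ->
          exists dpistar : R -> R, forall F : R, 0 <= F < 1 ->
            D_in (pistar t) dpistar (fun x => 0 <= x < 1) F
            /\ 0 <= dpistar F)
    /\ (forall (t : nat) (F : R), (S t < T)%nat -> 0 <= F < 1 ->
          pistar (S t) F <= pistar t F).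
Proof.
pose proof (fun n => continuation_regular p q C n hp hq hC) as Hreg.
assert (Hspec := fun n F HF => price_spec p q C n F hp (proj1 hq) hC HF
  (proj1 (Hreg n)) (proj2 (Hreg n))).
(* [T - 1 - t] is the number of periods after t, so later times mean fewer remaining periods. *)
exists (fun t => price p q C (T - 1 - t)). repeat split.
- apply (Hspec (T - 1 - t)%nat F H0).
- apply (Hspec (T - 1 - t)%nat F H0).
- apply (Hspec (T - 1 - t)%nat F H0).
- intros t F _ HF. now apply Hspec.
- intros t _.
  set (n := (T - 1 - t)%nat).
  (* The derivative is the secant slope on the diagonal. *)
  exists (fun x => price_slope p q (continuation_slope p q C n)
    x (price p q C n x) x (price p q C n x)).
  intros F HF. split.
  + apply (root_D_in p q C); [apply Hreg| |easy].
    intros x Hx. now apply Hspec.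
  + apply price_slope_nonneg; try easy. apply Hreg.
- intros t F Ht HF.
  replace (T - 1 - t)%nat with (S (T - 1 - S t)) by lia.
  now apply price_succ.
Qed.
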